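(* In the setting described in the context, let $I\subset\mathbb{R}$ be an interval, let $v:I\to X$ be continuous, and let $(\eta,\omega):I\to X\times\mathbb{R}^n$ be a classical solution of $$\dot\eta=B^\top\omega+v,\qquad M\dot\omega+D\omega=p-Bf(\eta),$$ where $f(\eta)=\operatorname{diag}(a)\sin\eta$, $\eta_*\in X$, $f_*=f(\eta_* )$ and $p=Bf_*$. Let $$V(\eta,\omega)=\tfrac12\omega^\top M\omega+D_U(\eta,\eta_* ),\qquad D_U(\eta,\eta_* )=U(\eta)-U(\eta_* )-f_*^\top(\eta-\eta_* ),\qquad U(\eta)=\sum_{e\in E}a_e(1-\cos\eta_e).$$ Then, along the solution, $$\dot V=-\omega^\top D\omega+\bigl(f(\eta)-f_*\bigr)^\top v .$$
   Context: $G=(V,E)$ is a finite connected graph with $n$ vertices, a fixed orientation of each edge, edge space $X=\mathbb{R}^E$, and incidence matrix $B:X\to\mathbb{R}^n$ whose column for each oriented edge has entry $+1$ at the tail and $-1$ at the head. $M,D\in\mathbb{R}^{n\times n}$ are positive diagonal, $a_e>0$ for all $e\in E$, and sine is applied componentwise. $\dot V$ denotes the derivative of $t\mapsto V(\eta(t),\omega(t))$. *)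

(* Defs.v *)
From mathcomp Require Import all_boot all_order all_algebra.
From mathcomp Require Import all_classical all_reals all_analysis.

Set Implicit Arguments.
Unset Strict Implicit.
Unset Printing Implicit Defensive.

Import Order.TTheory GRing.Theory Num.Theory.
Import numFieldNormedType.Exports.

Local Open Scope classical_set_scope.
Local Open Scope ring_scope.

(* Derivative at [t] of a map that only matters on [I]: the difference quotient
   is taken along points of [I], hence is one-sided at an endpoint of [I]. *)
Definition is_derive_within (R : realType) (W : normedModType R)
    (I : set R) (f : R -> W) (t : R) (df : W) : Prop :=
  (fun s : R => (s - t)^-1 *: (f s - f t)) @ within I t^' --> df.

(* A finite graph on ['I_n] whose edges, indexed by ['I_m], are oriented from
   [tail e] to [head e]; parallel edges are allowed, loops are not (the
   incidence column of a loop would be ill-defined). *)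
Record oriented_graph (n m : nat) := OrientedGraph {
  tail : 'I_m -> 'I_n;
  head : 'I_m -> 'I_n;
  loopless : forall e, tail e != head e }.

Definition adjacent n m (G : oriented_graph n m) : rel 'I_n :=
  fun i j => [exists e, ((tail G e == i) && (head G e == j))
                     || ((tail G e == j) && (head G e == i))].

Definition connected_graph n m (G : oriented_graph n m) : Prop :=
  (0 < n)%N /\ forall i j : 'I_n, connect (adjacent G) i j.

Section Network.
Variable R : realType.

Definition incidence n m (G : oriented_graph n m) : 'M[R]_(n, m) :=
  \matrix_(i, e) (if i == tail G e then 1
                  else if i == head G e then - 1 else 0).

Definition pos_diag_mx n (A : 'M[R]_n) : Prop :=
  is_diag_mx A /\ forall i, 0 < A i i.

Definition dotv k (x y : 'cV[R]_k) : R := (x^T *m y) 0 0.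

Definition flow m (a eta : 'cV[R]_m) : 'cV[R]_m :=
  diag_mx a^T *m map_mx sin eta.

Definition potential m (a eta : 'cV[R]_m) : R :=
  \sum_(e < m) a e 0 * (1 - cos (eta e 0)).

(* The gradient of [potential a] at [etas] is [flow a etas]. *)
Definition bregman m (a eta etas : 'cV[R]_m) : R :=
  potential a eta - potential a etas - dotv (flow a etas) (eta - etas).

Definition lyapunov n m (M : 'M[R]_n) (a etas : 'cV[R]_m)
    (eta : 'cV[R]_m) (omega : 'cV[R]_n) : R :=
  2^-1 * dotv omega (M *m omega) + bregman a eta etas.

Definition classical_solution n m (G : oriented_graph n m) (M D : 'M[R]_n)
    (a : 'cV[R]_m) (p : 'cV[R]_n) (I : set R) (v : R -> 'cV[R]_m)
    (eta : R -> 'cV[R]_m) (omega : R -> 'cV[R]_n) : Prop :=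
  forall t, I t -> exists (deta : 'cV[R]_m) (domega : 'cV[R]_n),
    [/\ is_derive_within I eta t deta,
        is_derive_within I omega t domega,
        deta = (incidence G)^T *m omega t + v t &
        M *m domega + D *m omega t = p - incidence G *m flow a (eta t)].

End Network.

(* Main.v *)
Require Import Defs.
From mathcomp Require Import all_boot all_order all_algebra.
From mathcomp Require Import all_classical all_reals all_analysis.
From mathcomp Require Import ring.

Set Implicit Arguments.
Unset Strict Implicit.
Unset Printing Implicit Defensive.

Import Order.TTheory GRing.Theory Num.Theory.
Import numFieldNormedType.Exports.

Local Open Scope classical_set_scope.
Local Open Scope ring_scope.

(** The identity is the chain rule followed by an energy balance.

    Since [M] is diagonal, the kinetic energy is a weighted sum of squares and
    its derivative along the curve is [dotv omega (M *m domega)]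
    ([is_derive_within_kinetic]).  The gradient of the Bregman term in [eta] is
    [flow a eta - flow a etas], because the potential has gradient [flow a]
    ([is_derive_within_bregman]).  Hence
      dV/dt = omega^T M domega + (f(eta) - f_* )^T deta.
    Inserting the equations of motion and [p = B f_*], the node equation gives
    [M domega = - B (f(eta) - f_* ) - D omega] and the edge equation gives
    [deta = B^T omega + v].  The power [omega^T B (f(eta) - f_* )] that leaves
    the nodes through [B] enters the edges through [B^T], so both contributions
    cancel, leaving the dissipation and the power supplied by [v]
    ([power_balance]).

    Differentiability is only known along the points of [I], which may contain
    its endpoints, so the chain rule cannot be quoted for ordinary derivatives;
    it is obtained for derivatives along a set from the factorisation in
    [is_derive_within_caratheodory]. *)

(** * Calculus for derivatives along a set *)

Section DeriveWithin.
Variables (R : realType) (I : set R) (t : R).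
Implicit Types (f g phi h : R -> R) (df dg dh : R).

(** Writing the difference quotient as a factor [phi] defined everywhere turns
    the product and chain rules into algebraic identities between factors. *)
Lemma is_derive_within_caratheodory f df :
  is_derive_within I f t df <->
  exists2 phi : R -> R, (forall s, f s - f t = phi s * (s - t)) &
    phi s @[s --> within I t^'] --> df.
Proof.
split=> [fd|[phi fE phid]].
  exists (fun s => (s - t)^-1 * (f s - f t)) => // s.
  have [->|st] := eqVneq s t; first by rewrite !subrr mulr0.
  by rewrite mulrAC mulVf ?mul1r// subr_eq0.
apply: cvg_trans phid; apply: near_eq_cvg.
have st0 : \forall s \near within I t^', s != t.
  by exact: (@cvg_within _ t^' _ I _ (nbhs_dnbhs_neq t)).
apply: filterS st0 => s st.
by rewrite /GRing.scale/= fE mulrC mulfK// subr_eq0.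
Qed.

Lemma is_derive_within_cvg f df :
  is_derive_within I f t df -> f s @[s --> within I t^'] --> f t.
Proof.
move=> /is_derive_within_caratheodory[phi fE phid].
have : (f t + phi s * (s - t)) @[s --> within I t^'] --> f t + df * (t - t).
  apply: cvgD; first exact: cvg_cst.
  apply: cvgM => //; apply: cvgB; last exact: cvg_cst.
  exact: cvg_trans (cvg_within _) (cvg_within _).
rewrite subrr mulr0 addr0; under eq_fun do rewrite -fE addrC subrK.
exact.
Qed.

Lemma is_derive_within_cst (c : R) : is_derive_within I (fun=> c) t 0.
Proof.
apply/is_derive_within_caratheodory; exists (fun=> 0); last exact: cvg_cst.
by move=> s; rewrite subrr mul0r.
Qed.

Lemma is_derive_withinD f g df dg :
  is_derive_within I f t df -> is_derive_within I g t dg ->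
  is_derive_within I (fun s => f s + g s) t (df + dg).
Proof.
move=> /is_derive_within_caratheodory[phi fE phid].
move=> /is_derive_within_caratheodory[psi gE psid].
apply/is_derive_within_caratheodory; exists (fun s => phi s + psi s).
  by move=> s; rewrite mulrDl -fE -gE opprD addrACA.
exact: cvgD.
Qed.

Lemma is_derive_withinM f g df dg :
  is_derive_within I f t df -> is_derive_within I g t dg ->
  is_derive_within I (fun s => f s * g s) t (df * g t + f t * dg).
Proof.
move=> fd gd; have gt := is_derive_within_cvg gd.
case/is_derive_within_caratheodory: fd => phi fE phid.
case/is_derive_within_caratheodory: gd => psi gE psid.
apply/is_derive_within_caratheodory.
exists (fun s => phi s * g s + f t * psi s).
  move=> s; rewrite mulrDl -(mulrA (f t)) -gE mulrAC -fE.
  by rewrite mulrBl mulrBr addrA subrK.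
by apply: cvgD; apply: cvgM => //; exact: cvg_cst.
Qed.

Lemma is_derive_withinZ (c : R) f df :
  is_derive_within I f t df -> is_derive_within I (fun s => c * f s) t (c * df).
Proof.
move=> fd; rewrite -[c * df]add0r -(mul0r (f t)).
exact: is_derive_withinM (is_derive_within_cst c) fd.
Qed.

Lemma is_derive_withinB f g df dg :
  is_derive_within I f t df -> is_derive_within I g t dg ->
  is_derive_within I (fun s => f s - g s) t (df - dg).
Proof.
move=> fd /(is_derive_withinZ (c := -1)) gd.
rewrite -mulN1r; under eq_fun do rewrite -mulN1r.
exact: is_derive_withinD.
Qed.

Lemma is_derive_within_sum k (f : 'I_k -> R -> R) (df : 'I_k -> R) :
  (forall i, is_derive_within I (f i) t (df i)) ->
  is_derive_within I (fun s => \sum_(i < k) f i s) t (\sum_(i < k) df i).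
Proof.
move=> fd; rewrite unlock /=; elim: (index_enum _) => [|i r IHr] /=.
  exact: is_derive_within_cst.
exact: is_derive_withinD.
Qed.

Lemma is_derive_within_comp h f df dh :
  is_derive (f t) 1 h dh -> is_derive_within I f t df ->
  is_derive_within I (fun s => h (f s)) t (dh * df).
Proof.
move=> /is_derive1_caratheodory[H [hE Hc <-]] fd.
have ft := is_derive_within_cvg fd.
case/is_derive_within_caratheodory: fd => phi fE phid.
apply/is_derive_within_caratheodory; exists (fun s => H (f s) * phi s).
  by move=> s; rewrite hE fE mulrA.
by apply: cvgM => //; exact: continuous_cvg Hc ft.
Qed.

Lemma is_derive_within_coord p q (x : R -> 'M[R]_(p, q)) dx i j :
  is_derive_within I x t dx -> is_derive_within I (fun s => x s i j) t (dx i j).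
Proof.
move=> xd; rewrite /is_derive_within.
rewrite (_ : (fun s => _) =
  (fun A : 'M[R]_(p, q) => A i j) \o (fun s => (s - t)^-1 *: (x s - x t))).
  by apply: continuous_cvg xd; exact: coord_continuous.
by apply/funext => s /=; rewrite !mxE.
Qed.

End DeriveWithin.

(** * Derivative of the Lyapunov function along a curve *)

Section EnergyDerivative.
Variables (R : realType) (I : set R) (t : R).

Lemma dotvE k (x y : 'cV[R]_k) : dotv x y = \sum_(i < k) x i 0 * y i 0.
Proof. by rewrite /dotv mxE; apply: eq_bigr => i _; rewrite mxE. Qed.

Lemma dotvDr k (x y z : 'cV[R]_k) : dotv x (y + z) = dotv x y + dotv x z.
Proof. by rewrite /dotv mulmxDr mxE. Qed.

Lemma dotvBl k (x y z : 'cV[R]_k) : dotv (x - y) z = dotv x z - dotv y z.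
Proof. by rewrite !dotvE -sumrB; apply: eq_bigr => i _; rewrite 2!mxE mulrBl. Qed.

Lemma dotvNr k (x y : 'cV[R]_k) : dotv x (- y) = - dotv x y.
Proof. by rewrite /dotv mulmxN mxE. Qed.

Lemma dotv_trmul k l (A : 'M[R]_(k, l)) (x : 'cV[R]_l) (y : 'cV[R]_k) :
  dotv x (A^T *m y) = dotv y (A *m x).
Proof.
rewrite /dotv mulmxA -trmx_mul -[in LHS](trmxK y) -trmx_mul.
by rewrite mxE.
Qed.

Lemma is_diag_mulE k (A : 'M[R]_k) (x : 'cV[R]_k) i :
  is_diag_mx A -> (A *m x) i 0 = A i i * x i 0.
Proof.
move=> /is_diag_mxP A0; rewrite mxE (bigD1 i)//= big1 ?addr0// => j ji.
by rewrite A0 ?mul0r// eq_sym.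
Qed.

Lemma flowE m (a eta : 'cV[R]_m) e : flow a eta e 0 = a e 0 * sin (eta e 0).
Proof. by rewrite /flow mul_diag_mx !mxE. Qed.

(** Diagonality makes [M] symmetric, so both factors of the quadratic form
    contribute equally and the factor [2^-1] disappears. *)
Lemma is_derive_within_kinetic n (M : 'M[R]_n) (omega : R -> 'cV[R]_n) domega :
  is_diag_mx M -> is_derive_within I omega t domega ->
  is_derive_within I (fun s => 2^-1 * dotv (omega s) (M *m omega s)) t
    (dotv (omega t) (M *m domega)).
Proof.
move=> Md od.
have -> : (fun s => 2^-1 * dotv (omega s) (M *m omega s)) =
    (fun s => \sum_(i < n) (2^-1 * M i i) * (omega s i 0 * omega s i 0)).
  apply/funext => s; rewrite dotvE big_distrr; apply: eq_bigr => i _ /=.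
  by rewrite is_diag_mulE// -mulrA; congr (_ * _); rewrite mulrCA.
have -> : dotv (omega t) (M *m domega) = \sum_(i < n) (2^-1 * M i i) *
    (domega i 0 * omega t i 0 + omega t i 0 * domega i 0).
  rewrite dotvE; apply: eq_bigr => i _; rewrite is_diag_mulE//.
  by field.
apply: is_derive_within_sum => i; apply: is_derive_withinZ.
by apply: is_derive_withinM; exact: is_derive_within_coord.
Qed.

(** The linear term of the Bregman distance shifts the gradient by the constant
    [flow a etas], so that it vanishes at [etas]. *)
Lemma is_derive_within_bregman m (a etas : 'cV[R]_m) (eta : R -> 'cV[R]_m)
    deta :
  is_derive_within I eta t deta ->
  is_derive_within I (fun s => bregman a (eta s) etas) t
    (dotv (flow a (eta t) - flow a etas) deta).
Proof.
move=> ed.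
(* The right-hand side has the shape that the differentiation rules produce. *)
have -> : dotv (flow a (eta t) - flow a etas) deta =
    \sum_(e < m) a e 0 * (0 - - sin (eta t e 0) * deta e 0) - 0 -
    \sum_(e < m) flow a etas e 0 * (deta e 0 - 0).
  rewrite dotvBl !dotvE subr0 -!sumrB; apply: eq_bigr => e _.
  by rewrite !flowE; ring.
have -> : (fun s => bregman a (eta s) etas) =
    (fun s => \sum_(e < m) a e 0 * (1 - cos (eta s e 0)) - potential a etas -
      \sum_(e < m) flow a etas e 0 * (eta s e 0 - etas e 0)).
  apply/funext => s; rewrite /bregman dotvE; congr (_ - _).
  by apply: eq_bigr => e _; congr (_ * _); rewrite !mxE.
have ecd e : is_derive_within I (fun s => eta s e 0) t (deta e 0).
  exact: is_derive_within_coord.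
apply: is_derive_withinB; first apply: is_derive_withinB.
- apply: is_derive_within_sum => e; apply: is_derive_withinZ.
  apply: is_derive_withinB; first exact: is_derive_within_cst.
  exact: is_derive_within_comp.
- exact: is_derive_within_cst.
- apply: is_derive_within_sum => e; apply: is_derive_withinZ.
  by apply: is_derive_withinB => //; exact: is_derive_within_cst.
Qed.

End EnergyDerivative.

(** * Energy balance *)

(** [B] and [B^T] are adjoint, so the power exchanged between the nodes and the
    edges cancels. *)
Lemma power_balance (R : realType) n m (B : 'M[R]_(n, m)) (M D : 'M[R]_n)
    (omega domega : 'cV[R]_n) (f fs v : 'cV[R]_m) :
  M *m domega + D *m omega = B *m fs - B *m f ->
  dotv omega (M *m domega) + dotv (f - fs) (B^T *m omega + v) =
  - dotv omega (D *m omega) + dotv (f - fs) v.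
Proof.
move=> /(canRL (addrK _)) ->.
rewrite -mulmxBr -(opprB f) mulmxN !dotvDr !dotvNr dotv_trmul.
by rewrite addrA; congr (_ + _); rewrite addrAC addNr add0r.
Qed.

Theorem lemma12p12 (R : realType) (n m : nat) (G : oriented_graph n m)
    (hG : connected_graph G)
    (M D : 'M[R]_n) (hM : pos_diag_mx M) (hD : pos_diag_mx D)
    (a : 'cV[R]_m) (ha : forall e, 0 < a e 0)
    (I : set R) (hI : is_interval I)
    (v : R -> 'cV[R]_m) (hv : {within I, continuous v})
    (etas : 'cV[R]_m) (p : 'cV[R]_n)
    (hp : p = incidence R G *m flow a etas)
    (eta : R -> 'cV[R]_m) (omega : R -> 'cV[R]_n)
    (hsol : classical_solution G M D a p I v eta omega) :
  forall t, I t ->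
    is_derive_within I (fun s => lyapunov M a etas (eta s) (omega s)) t
      (- dotv (omega t) (D *m omega t)
       + dotv (flow a (eta t) - flow a etas) (v t)).
Proof.
move=> t It.
have [deta [domega [etad omegad detaE nodeE]]] := hsol t It.
rewrite hp in nodeE; rewrite -(power_balance _ nodeE) -detaE.
apply: is_derive_withinD; last exact: is_derive_within_bregman.
exact: is_derive_within_kinetic hM.1 omegad.
Qed.
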